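(* Let $T\colon X\rightrightarrows X$ be a set-valued operator given by $T(x)=\{T_i(x): i\in\varphi(x)\}$ for all $x\in X$, where $I$ is a finite index set, $\varphi\colon X\rightrightarrows I$ is an osc operator with nonempty values, and $\{T_i\}_{i\in I}$ is a collection of single-valued operators $T_i\colon X\to X$. The following assertions hold. (a) For each $i\in I$, the set $\varphi^{-1}(i)$ is closed, and $X=\bigcup_{i\in I}\varphi^{-1}(i)$. (b) $x\in\operatorname{Fix}T$ if and only if there exists $i\in I$ such that $x\in\varphi^{-1}(i)\cap\operatorname{Fix}T_i$. Consequently, $\operatorname{Fix}T=\bigcup_{i\in I}\left[\varphi^{-1}(i)\cap\operatorname{Fix}T_i\right]$. (c) $x\in\mathbf{Fix}\,T$ if and only if $x\in\bigcap_{i\in\varphi(x)}\operatorname{Fix}T_i=\bigcap_{i\in\varphi(x)}\left[\varphi^{-1}(i)\cap\operatorname{Fix}T_i\right]$. (d) $\mathbf{Fix}\,T=\operatorname{Fix}T\cap\operatorname{Sing}T$. (e) If in addition $\{T_i\}_{i\in I}$ is a collection of continuous operators, then $T$ is osc. Consequently, $\operatorname{Sing}T=\{x\in X:\operatorname{Limsup}_{x'\to x}T(x')\text{ is a singleton}\}$.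
   Context: $X$ is a real finite-dimensional Hilbert space. For a set-valued map $\phi\colon X\rightrightarrows Y$, $\operatorname{Limsup}_{x\to\bar x}\phi(x):=\{y\in Y:\exists\,x_n\to\bar x,\ \exists\,y_n\to y\text{ with }y_n\in\phi(x_n)\}$ (the terms $x_n=\bar x$ are allowed); $\phi$ is outer semicontinuous (osc) at $\bar x$ if $\operatorname{Limsup}_{x\to\bar x}\phi(x)\subseteq\phi(\bar x)$, and osc if it is osc at every point. Finite index sets carry the discrete topology. $\varphi^{-1}(i):=\{x\in X: i\in\varphi(x)\}$. For $T\colon X\rightrightarrows X$: the fixed point set is $\operatorname{Fix}T:=\{x:x\in T(x)\}$, the strong fixed point set is $\mathbf{Fix}\,T:=\{x:T(x)=\{x\}\}$, and the single-valued set is $\operatorname{Sing}T:=\{x\in X:T(x)\text{ is a singleton}\}$. For single-valued $T_i$, $\operatorname{Fix}T_i=\{x:T_i(x)=x\}$.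
   Formalization: In (c) the equality of the two intersections, false as an equality of sets (X=R, T_1=T_2=id, φ(0)={1,2}, φ(y)={1} for y≠0, at x=0), is replaced by: x belongs to the first intersection if and only if x belongs to the second. *)

(* Defs.v *)
From HB Require Import structures.
From mathcomp Require Import all_boot all_order all_algebra.
From mathcomp Require Import all_classical all_reals all_analysis.
Set Implicit Arguments.
Unset Strict Implicit.
Unset Printing Implicit Defensive.
Import Order.TTheory GRing.Theory Num.Theory.
Import numFieldNormedType.Exports.
Local Open Scope classical_set_scope.
Local Open Scope ring_scope.

HB.mixin Record NormedModule_isHilbert (R : realType) X
    & NormedModule R X := {
  inner : {dot X for (@idfun R)} ;
  norm_innerE : forall x : X, `|x| = Num.sqrt (inner x x)
}.

(* Finite dimensionality is the vectType structure, a linear isomorphism with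
   some 'rV[R]_n. The row vectors 'rV[R]_n of the library are not themselves an
   instance for 1 < n, because their norm is the supremum norm. *)
#[short(type="finDimHilbertType")]
HB.structure Definition FinDimHilbert (R : realType) :=
  { X of CompleteNormedModule R X & Vector R X & NormedModule_isHilbert R X }.

Definition is_singleton (U : Type) (A : set U) : Prop :=
  exists y, A = [set y].

Definition Limsup (X Y : topologicalType) (phi : X -> set Y) (a : X) : set Y :=
  [set y | exists (x_ : nat -> X) (y_ : nat -> Y),
    [/\ x_ @ \oo --> a, y_ @ \oo --> y & forall n, phi (x_ n) (y_ n)]].

Definition osc_at (X Y : topologicalType) (phi : X -> set Y) (a : X) : Prop :=
  Limsup phi a `<=` phi a.

Definition osc (X Y : topologicalType) (phi : X -> set Y) : Prop :=
  forall a, osc_at phi a.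

Definition inverse_image (U V : Type) (phi : U -> set V) (v : V) : set U :=
  [set x | phi x v].

Definition Fix (U : Type) (T : U -> set U) : set U := [set x | T x x].

Definition strongFix (U : Type) (T : U -> set U) : set U :=
  [set x | T x = [set x]].

Definition Sing (U V : Type) (T : U -> set V) : set U :=
  [set x | is_singleton (T x)].

Definition fixpts (U : Type) (f : U -> U) : set U := [set x | f x = x].

(* Main.v *)
Require Import Defs.
From mathcomp Require Import all_boot all_order all_algebra.
From mathcomp Require Import all_classical all_reals all_analysis.
Import Order.TTheory Num.Theory numFieldNormedType.Exports.
Local Open Scope classical_set_scope.

(** Assertions (a) and (e) are topological; (b), (c) and (d) only unfold the
    formula [T x = {Ti i x : i in phi x}]; in (c) it matters that [phi x] is
    nonempty, since otherwise [T x] would be empty while the intersection over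
    [phi x] would be the whole space.

    For (a), take [x] in the closure of a fibre of [phi] over [i]. A sequence
    of points of the fibre tends to [x], the constant sequence [i] tends to
    [i], so [i] belongs to [Limsup phi x], hence to [phi x] by outer
    semicontinuity ([osc_closed_inverse_image]).

    For (e), the graph of [T] is the union over [i] of the graph of [Ti i]
    restricted to the closed fibre of [phi] over [i]. Each piece is closed
    since [Ti i] is continuous with values in a Hausdorff space, and there are
    finitely many pieces, so the graph of [T] is closed ([closed_graph_finite]).
    A closed graph contains the limits of its sequences, that is, [T] is osc
    ([closed_graph_osc]). This replaces the usual extraction of a subsequence
    along which the selected index is constant. Finally an osc map equals its
    own [Limsup] ([osc_LimsupE]), because constant sequences are allowed. *)

(** First countability of [M] makes this true: [Limsup] only sees sequences,
    whereas [closure] is defined by neighborhoods. *)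
Lemma osc_closed_inverse_image (R : realType) (M : pseudoMetricType R)
    (Y : topologicalType) (phi : M -> set Y) (y : Y) :
  osc phi -> closed (inverse_image phi y).
Proof.
move=> phi_osc a cla; apply: (phi_osc a).
have near_a n : exists x, phi x y /\ ball a (n.+1%:R^-1)%R x.
  have [|x [? ?]] := cla (ball a (n.+1%:R^-1)%R).
    by apply: nbhsx_ballx; rewrite invr_gt0.
  by exists x.
have [x_ x_P] := choice near_a.
exists x_, (fun=> y); split; [|exact: cvg_cst|by move=> n; case: (x_P n)].
apply/cvg_ballP => e e0; near=> n.
apply: (@le_ball _ _ _ (n.+1%:R^-1)%R); last by case: (x_P n).
by apply: ltW; near: n; exact: near_infty_natSinv_lt (PosNum e0).
Unshelve. all: by end_near. Qed.

Lemma closed_graph (X Y : topologicalType) (f : X -> Y) :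
  hausdorff_space Y -> continuous f -> closed [set p : X * Y | f p.1 = p.2].
Proof.
move=> hY fc [a y] cl; apply: hY => A B fA yB.
have [|[x z] /= [<- [fxA fxB]]] := cl ((f @^-1` A) `*` B).
  by exists (f @^-1` A, B) => //; split => //; exact: fc.
by exists (f x).
Qed.

Lemma closed_graph_finite (X Y : topologicalType) (I : finType)
    (A : I -> set X) (f : I -> X -> Y) :
  hausdorff_space Y -> (forall i, closed (A i)) ->
  (forall i, continuous (f i)) ->
  closed [set p : X * Y | exists2 i, A i p.1 & f i p.1 = p.2].
Proof.
move=> hY Acl fc.
rewrite (_ : mkset _ = \bigcup_(i in [set: I])
    ((fst @^-1` A i) `&` [set p | f i p.1 = p.2])); last first.
  by apply/seteqP; split=> p [i]; [exists i|move=> _ [? ?]; exists i].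
apply: closed_bigcup => [|i _]; first exact: finite_finset.
apply: closedI; last exact: (closed_graph X Y).
by apply: preimage_closed => // p _; exact: cvg_fst.
Qed.

Lemma closed_graph_osc (X Y : topologicalType) (T : X -> set Y) :
  closed [set p : X * Y | T p.1 p.2] -> osc T.
Proof.
move=> Tcl a y [x_ [y_ [x_a y_y Txy]]].
apply: (@closed_cvg _ _ \oo _ (fun n => (x_ n, y_ n)) (fun p => T p.1 p.2)
    Tcl _ (a, y)).
- exact: nearW Txy.
- exact: cvg_pair x_a y_y.
Qed.

Lemma osc_LimsupE (X Y : topologicalType) (T : X -> set Y) (a : X) :
  osc_at T a -> Limsup T a = T a.
Proof.
move=> Tosc; apply/seteqP; split=> // y Tay.
by exists (fun=> a), (fun=> y); split => //; exact: cvg_cst.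
Qed.

Lemma strongFixE (U : Type) (T : U -> set U) :
  strongFix T = Fix T `&` Sing T.
Proof.
apply/seteqP; split=> x.
  by move=> Tx; split; [rewrite /Fix /= Tx|exists x].
by move=> [Txx [y Ty]]; move: Txx; rewrite /Fix /strongFix /= Ty => ->.
Qed.

Lemma image_set1P (V I : Type) (P : set I) (f : I -> V) (v : V) :
  P !=set0 -> [set f i | i in P] = [set v] <-> (forall i, P i -> f i = v).
Proof.
move=> [i0 Pi0]; split=> [fP i Pi | fP].
  have : [set f i | i in P] (f i) by exists i.
  by rewrite fP.
apply/seteqP; split=> w; first by move=> [i Pi <-]; exact: fP.
by move=> ->; exists i0 => //; exact: fP.
Qed.

Theorem proposition3p3 (R : realType) (X : finDimHilbertType R) (I : finType)
    (phi : X -> set (discrete_topology I)) (Ti : I -> X -> X)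
    (T : X -> set X)
    (phi_osc : osc phi)
    (phi_neq0 : forall x, phi x !=set0)
    (TE : forall x, T x = [set Ti i x | i in phi x]) :
  (* (a) *)
  ((forall i : I, closed (inverse_image phi i)) /\
   [set: X] = \bigcup_(i in [set: I]) inverse_image phi i) /\
  (* (b) *)
  ((forall x, x \in Fix T <->
      exists i : I, x \in inverse_image phi i `&` fixpts (Ti i)) /\
   Fix T = \bigcup_(i in [set: I]) (inverse_image phi i `&` fixpts (Ti i))) /\
  (* (c) *)
  (forall x,
    (x \in strongFix T <-> x \in \bigcap_(i in phi x) fixpts (Ti i)) /\
    (x \in \bigcap_(i in phi x) fixpts (Ti i) <->
     x \in \bigcap_(i in phi x) (inverse_image phi i `&` fixpts (Ti i)))) /\
  (* (d) *)
  strongFix T = Fix T `&` Sing T /\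
  (* (e) *)
  ((forall i : I, continuous (Ti i)) ->
   osc T /\ Sing T = [set x | is_singleton (Limsup T x)]).
Proof.
have phi_closed (i : I) : closed (inverse_image phi i).
  exact: (osc_closed_inverse_image R X _ phi i).
have FixE : Fix T = \bigcup_(i in [set: I])
    (inverse_image phi i `&` fixpts (Ti i)).
  apply/seteqP; split=> x; rewrite /Fix /= TE; first by move=> [i ? ?]; exists i.
  by move=> [i _ [? ?]]; exists i.
split; last split; last split; last split.
- split=> //; apply/seteqP; split=> // x _.
  by have [i phixi] := phi_neq0 x; exists i.
- split=> // x; rewrite FixE inE; split.
    by move=> [i _ ?]; exists i; rewrite inE.
  by move=> [i]; rewrite inE => ?; exists i.
- move=> x; rewrite !inE; split; last first.
    by split=> fixTi i phixi; [split=> //; exact: fixTi|case: (fixTi i phixi)].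
  rewrite /strongFix /= TE.
  exact: (image_set1P _ _ (phi x) (Ti^~ x) x (phi_neq0 x)).
- exact: strongFixE.
- move=> Tic; have Tosc : osc T.
    apply: closed_graph_osc.
    have := closed_graph_finite X X I (inverse_image phi) Ti
      (@norm_hausdorff _ X) phi_closed Tic.
    by congr closed; apply/seteqP; split=> -[x y]; rewrite /= TE.
  by split=> //; apply/seteqP; split=> x; rewrite /Sing /= osc_LimsupE.
Qed.
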